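(* Let $(L,[,\ldots,],\alpha=(\alpha_1,\ldots,\alpha_{n-1}))$ be an $n$-ary Hom-Nambu algebra with $n\ge 3$. Suppose $a\in L$ satisfies $$\alpha_1(a)=a\quad\text{and}\quad[a,x_2,\ldots,x_{n-1},a]=0\ \text{ for all }x_2,\ldots,x_{n-1}\in L.$$ Then $L'=(L,[,\ldots,]',\alpha'=(\alpha_2,\ldots,\alpha_{n-1}))$ is an $(n-1)$-ary Hom-Nambu algebra, where $$[x_1,\ldots,x_{n-1}]'=[a,x_1,\ldots,x_{n-1}]$$ for $x_i\in L$. Moreover, if $L$ is multiplicative, then so is $L'$.
   Context: We work over a fixed field $\mathbf{k}$ of characteristic $0$. For an integer $n\ge 2$, an $n$-ary Hom-algebra $(V,[,\ldots,],\alpha=(\alpha_1,\ldots,\alpha_{n-1}))$ consists of a $\mathbf{k}$-module $V$, an $n$-linear map $[,\ldots,]\colon V^{\otimes n}\to V$, and linear maps $\alpha_i\colon V\to V$ ($1\le i\le n-1$), called twisting maps. It is multiplicative if $\alpha_1=\cdots=\alpha_{n-1}=\alpha$ and $\alpha\circ[,\ldots,]=[,\ldots,]\circ\alpha^{\otimes n}$. An $n$-ary Hom-Nambu algebra is an $n$-ary Hom-algebra satisfying the $n$-ary Hom-Nambu identity $$[\alpha_1(x_1),\ldots,\alpha_{n-1}(x_{n-1}),[y_1,\ldots,y_n]]=\sum_{i=1}^n[\alpha_1(y_1),\ldots,\alpha_{i-1}(y_{i-1}),[x_1,\ldots,x_{n-1},y_i],\alpha_i(y_{i+1}),\ldots,\alpha_{n-1}(y_n)]$$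 for all $x_1,\ldots,x_{n-1},y_1,\ldots,y_n\in V$. *)

(* Defs.v *)
From HB Require Import structures.
From mathcomp Require Import all_boot all_order all_algebra.

Set Implicit Arguments.
Unset Strict Implicit.
Unset Printing Implicit Defensive.

Import GRing.Theory.
Local Open Scope ring_scope.

(* The arity n >= 2 is written n = m.+2, so that a bracket takes m.+2 arguments
   and there are n - 1 = m.+1 twisting maps.  Indices start at 0: the informal
   alpha_1, ..., alpha_(n-1) are alpha 0, ..., alpha m. *)
Section HomNambu.
Variables (k : fieldType) (V : lmodType k).

Definition tuple_upd (n : nat) (x : n.-tuple V) (i : 'I_n) (u : V) : n.-tuple V :=
  [tuple if j == i then u else tnth x j | j < n].

Definition multilinear (n : nat) (br : n.-tuple V -> V) : Prop :=
  forall (i : 'I_n) (x : n.-tuple V), linear (fun u => br (tuple_upd x i u)).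

Record hom_algebra (m : nat) (br : m.+2.-tuple V -> V)
    (alpha : 'I_m.+1 -> V -> V) : Prop := HomAlgebra {
  hom_algebra_bracket : multilinear br;
  hom_algebra_twist : forall i, linear (alpha i) }.

(* The i-th summand on the right: "unlift i j" is None when j = i; otherwise it
   is the index j if j < i and j - 1 if i < j, so that y_j is twisted by alpha_j
   before the inner bracket and by alpha_(j-1) after it. *)
Definition hom_nambu_identity (m : nat) (br : m.+2.-tuple V -> V)
    (alpha : 'I_m.+1 -> V -> V) : Prop :=
  forall (x : m.+1.-tuple V) (y : m.+2.-tuple V),
    br [tuple of rcons [tuple alpha i (tnth x i) | i < m.+1] (br y)]
    = \sum_(i < m.+2)
        br [tuple if unlift i j is Some l then alpha l (tnth y j)
                  else br [tuple of rcons x (tnth y i)] | j < m.+2].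

Record hom_nambu_algebra (m : nat) (br : m.+2.-tuple V -> V)
    (alpha : 'I_m.+1 -> V -> V) : Prop := HomNambuAlgebra {
  hom_nambu_hom_algebra : hom_algebra br alpha;
  hom_nambu_identityP : hom_nambu_identity br alpha }.

Definition hom_multiplicative (m : nat) (br : m.+2.-tuple V -> V)
    (alpha : 'I_m.+1 -> V -> V) : Prop :=
  exists f : V -> V, (forall i, alpha i =1 f) /\
    (forall x : m.+2.-tuple V, f (br x) = br [tuple of map f x]).

End HomNambu.

(* Main.v *)
Require Import Defs.
From mathcomp Require Import all_boot all_order all_algebra.
Import GRing.Theory.
Local Open Scope ring_scope.

(* Put x_1 = y_1 = a in the n-ary identity.  On the right, the summand i = 1
   contains the inner bracket [a, x_2, ..., x_(n-1), a] = 0; in every other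
   summand the first entry is alpha_1 a = a, as it is on the left. *)

Lemma unlift_lift0 (n : nat) (i j : 'I_n.+1) :
  unlift (lift ord0 i) (lift ord0 j) = omap (lift ord0) (unlift i j).
Proof.
case: (unliftP i j) => [l ->|->] /=; last by rewrite unlift_none.
have -> : lift ord0 (lift i l) = lift (lift ord0 i) (lift ord0 l).
  by apply: val_inj; rewrite /= /bump /= !add1n ltnS addnS.
by rewrite liftK.
Qed.

Lemma unlift_lift00 (n : nat) (i : 'I_n.+1) :
  unlift (lift ord0 i) ord0 = Some ord0.
Proof.
have -> : ord0 = lift (lift ord0 i) ord0 by apply: val_inj.
by rewrite liftK.
Qed.

Lemma multilinear0 (k : fieldType) (V : lmodType k) (n : nat)
    (br : n.-tuple V -> V) (x : n.-tuple V) (i : 'I_n) :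
  multilinear br -> tnth x i = 0 -> br x = 0.
Proof.
(* With scalar -1 and both vectors 0, linearity reads b = -b + b, where b is the bracket with 0 in
   slot [i]. *)
move=> lin_br xi0; have br_i := lin_br i x (-1) 0 0.
have <- : tuple_upd x i 0 = x.
  apply: eq_from_tnth => j; rewrite tnth_mktuple.
  by case: eqP => // ->.
by rewrite scaler0 addr0 scaleN1r addNr in br_i.
Qed.

Lemma tuple_upd_cons (k : fieldType) (V : lmodType k) (n : nat) (a u : V)
    (x : n.-tuple V) (i : 'I_n) :
  [tuple of a :: tuple_upd x i u] = tuple_upd [tuple of a :: x] (lift ord0 i) u.
Proof.
apply: eq_from_tnth => j; rewrite tnth_mktuple.
case: (unliftP ord0 j) => [l ->|->]; last by rewrite !tnth0.
by rewrite !tnthS tnth_mktuple (inj_eq (@lift_inj _ ord0)).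
Qed.

Theorem theorem6p2 (k : fieldType) (char0 : [pchar k] =i pred0)
    (L : lmodType k) (m : nat)
    (br : m.+3.-tuple L -> L) (alpha : 'I_m.+2 -> L -> L) (a : L)
    (hL : hom_nambu_algebra br alpha)
    (alpha1_a : alpha ord0 a = a)
    (br_a_a : forall x : m.+1.-tuple L, br [tuple of a :: rcons x a] = 0) :
  let br' := fun x : m.+2.-tuple L => br [tuple of a :: x] in
  let alpha' := fun i : 'I_m.+1 => alpha (lift ord0 i) in
  hom_nambu_algebra br' alpha' /\
  (hom_multiplicative br alpha -> hom_multiplicative br' alpha').
Proof.
move=> br' alpha'; case: hL => -[lin_br lin_alpha] nambu; split; last first.
  (* The same [f] works: it agrees with [alpha ord0], so it fixes [a]. *)
  case=> f [alphaE f_br]; exists f; split=> [i|x]; first exact: alphaE.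
  rewrite /br' f_br; congr br; apply: val_inj => /=.
  by rewrite -(alphaE ord0) alpha1_a.
split; first split.
- move=> i x c u v; rewrite /br' !tuple_upd_cons; exact: lin_br.
- by move=> i; apply: lin_alpha.
move=> x y; rewrite /br'.
have := nambu [tuple of a :: x] [tuple of a :: y].
rewrite big_ord_recl [X in _ = X + _](multilinear0 _ _ _ _ _ ord0 lin_br);
  last first.
  rewrite tnth_mktuple unlift_none tnth0 -[RHS](br_a_a x).
  by congr br; apply: val_inj.
rewrite add0r => identity.
transitivity (br [tuple of rcons [tuple alpha i (tnth [tuple of a :: x] i)
                                 | i < m.+2] (br [tuple of a :: y])]).
  congr br; apply: val_inj => /=.
  rewrite (enum_ordSl m.+1) /= tnth0 alpha1_a -map_comp; congr (_ :: rcons _ _).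
  by apply: eq_map => i /=; rewrite tnthS.
rewrite identity; apply: eq_bigr => i _; congr br.
apply: eq_from_tnth => j; rewrite tnth_mktuple.
case: (unliftP ord0 j) => [l ->|->]; last by rewrite unlift_lift00 !tnth0.
rewrite unlift_lift0 !tnthS tnth_mktuple.
(* What remains is the slot of the inner bracket, where both sides list [a], then [x], then the
   [i]-th entry of [y]. *)
case: (unlift i l) => [p|] //=.
by congr br; apply: val_inj.
Qed.
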